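(* Let $t$ be a positive integer and let $C$ be a perfect $t$-deletion code of length $n$ with $n>t$. Then $$\# C \ge \frac{2^n}{\binom{n-1}{t}}\cdot\frac{\lfloor n^{1/3}\rfloor+1}{\lfloor n^{1/3}\rfloor+1+2t}\cdot\frac{\binom{\lfloor n^{2/3}\rfloor+t-1}{t}}{\binom{\lfloor n^{2/3}\rfloor+\lfloor n^{1/3}\rfloor+3t-1}{t}}\cdot\left(1-\sum_{r<\lfloor n^{1/3}\rfloor-1+\lfloor n^{2/3}\rfloor+t}\frac{\binom{n-1}{r}}{2^{n-1}}-\sum_{r>n-1-\lfloor n^{2/3}\rfloor+t}\frac{\binom{n-1}{r}}{2^{n-1}}\right),$$ where the sums run over integers $r$ and $\binom{n-1}{r}=0$ for $r<0$ or $r>n-1$.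
   Context: Let $\mathbb{B}=\{0,1\}$ and $\mathbb{B}^n$ the set of binary sequences of length $n$ ($\mathbb{B}^0=\{\epsilon\}$). For a binary sequence $\mathbf{x}$, $\mathrm{dS}^t(\mathbf{x})$ denotes the set of sequences obtained from $\mathbf{x}$ by deleting exactly $t$ symbols, and $\mathrm{dS}^t(X)=\bigcup_{\mathbf{x}\in X}\mathrm{dS}^t(\mathbf{x})$. A set $C\subseteq\mathbb{B}^n$ is a $t$-deletion code of length $n$ if $\mathrm{dS}^t(\mathbf{c})\cap\mathrm{dS}^t(\mathbf{d})=\emptyset$ for all distinct $\mathbf{c},\mathbf{d}\in C$; it is perfect if additionally $\mathrm{dS}^t(C)=\mathbb{B}^{n-t}$. $\#X$ is the cardinality of $X$. *)

(* Defs.v *)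
From mathcomp Require Import all_boot all_order all_algebra.
From mathcomp Require Import reals exp.

Set Implicit Arguments.
Unset Strict Implicit.
Unset Printing Implicit Defensive.

(* The mask m keeps the positions carrying true and deletes the others, so     *)
(* exactly t positions are deleted. If n < t no such mask exists and the       *)
(* sphere is empty, although n - t = 0 then.                                   *)
Definition dS (t n : nat) (x : n.-tuple bool) : {set (n - t).-tuple bool} :=
  [set y : (n - t).-tuple bool |
    [exists m : n.-tuple bool,
       (count_mem false m == t) && (val y == mask m x)]].

Definition dS_set (t n : nat) (X : {set n.-tuple bool}) :
    {set (n - t).-tuple bool} :=
  \bigcup_(x in X) dS t x.

Definition deletion_code (t n : nat) (C : {set n.-tuple bool}) : Prop :=
  forall c d : n.-tuple bool, c \in C -> d \in C -> c <> d ->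
    dS t c :&: dS t d = set0.

Definition perfect_deletion_code (t n : nat) (C : {set n.-tuple bool}) : Prop :=
  deletion_code t C /\ dS_set t C = [set: (n - t).-tuple bool].

Local Open Scope ring_scope.

(* Num.truncn is the floor, as a natural number, on nonnegative arguments.     *)
Definition floor_cbrt (R : realType) (n : nat) : nat :=
  Num.truncn ((n%:R : R) `^ (1 / 3%:R)).

Definition floor_cbrt_sqr (R : realType) (n : nat) : nat :=
  Num.truncn ((n%:R : R) `^ (2%:R / 3%:R)).

(* Main.v *)
(* Weight each received word y by 1/'C(r(y) + 3t - 1, t), where r counts the runs.
   Deleting t symbols removes at most 2t runs, and a word with r runs has at most
   'C(r + t - 1, t) subsequences of colength t, so each deletion sphere has total
   weight at most 1. As the spheres cover all words of length n - t, #|C| is at least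
   the total weight of these words, namely
     \sum_s 2 'C(n - t - 1, s) / 'C(s + 3t, t)
       = 2 / 'C(n - 1, t) * \sum_s 'C(n - 1, s + t) * ('C(s + t, t) / 'C(s + 3t, t)),
   and the last ratio increases with s. *)
Require Import Defs.
From mathcomp Require Import all_boot all_order all_algebra.
From mathcomp Require Import reals exp.
From mathcomp Require Import zify ring.

Import Order.TTheory GRing.Theory Num.Theory.

(** * Runs of a word under deletion *)

Fixpoint changes (a : bool) (x : seq bool) : nat :=
  if x is b :: x' then (a != b) + changes b x' else 0.

Definition runs (x : seq bool) : nat :=
  if x is a :: x' then (changes a x').+1 else 0.

Lemma changes_le_size (a : bool) (x : seq bool) : changes a x <= size x.
Proof. by elim: x a => //= b x IH a; have := IH b; case: (a != b); lia. Qed.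

Lemma changes_start (a b : bool) (x : seq bool) :
  changes a x <= (changes b x).+1.
Proof. by case: x => //= c x; case: (a != c); lia. Qed.

(** Each deleted symbol destroys at most two changes; the additive form avoids truncated
    subtraction. *)
Lemma changes_subseq (a : bool) (y x : seq bool) :
  subseq y x -> changes a x + 2 * size y <= changes a y + 2 * size x.
Proof.
elim: x a y => [|b x IH] a [|c y] //=.
  by move=> _; have := changes_le_size b x; case: (a != b); lia.
case: eqP => [-> /(IH b)|_ /(IH b) /=]; first by case: (a != b); lia.
(* Here [b] is deleted: one change may be lost at [a != b], and one more when [a] replaces [b]
   before [c]. *)
have := changes_start b a (c :: y); rewrite /=.
by case: (a != b); case: (a != c); case: (b != c); lia.
Qed.

Lemma runs_subseq (y x : seq bool) :
  0 < size y -> subseq y x -> runs x + 2 * size y <= runs y + 2 * size x.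
Proof.
case: y x => [|c y] [|b x] //= _.
case: eqP => [->|_] /(changes_subseq b) /=; first by lia.
by have := changes_start b c y; case: (b != c); lia.
Qed.

(** * Size of a deletion sphere *)

(** Multisets of size [t] on [r] types; with the truncated predecessor, [r = 0] still gives 1 if
    [t = 0] and 0 otherwise. *)
Definition multichoose (r t : nat) : nat := 'C((r + t).-1, t).

Lemma multichooseS (r t : nat) :
  multichoose r.+1 t.+1 = multichoose r.+1 t + multichoose r t.+1.
Proof. by rewrite /multichoose !addSn !addnS /= binS addnC. Qed.

Lemma multichoose0 (r : nat) : multichoose r 0 = 1.
Proof. by rewrite /multichoose bin0. Qed.

Lemma leq_multichoose (r s t : nat) :
  r <= s -> multichoose r t <= multichoose s t.
Proof. by move=> le_rs; apply: leq_bin2l; lia. Qed.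

(* A subsequence of a :: x is either one of x with one deletion less, or it keeps
   the first run whole; the second part of the statement bounds the latter. *)
Lemma subseq_cover (x : seq bool) (t : nat) :
  (exists2 L : seq (seq bool), size L <= multichoose (runs x) t &
     forall y : seq bool, subseq y x -> size y + t = size x -> y \in L) /\
  (exists2 L : seq (seq bool), size L <= multichoose (runs x).-1 t &
     forall y : seq bool, subseq y x -> ~~ subseq y (behead x) ->
       size y + t = size x -> y \in L).
Proof.
elim: x t => [|a x IH] t.
  split; last by exists [::] => //= y ->.
  case: t => [|t]; last by exists [::] => //= y; lia.
  by exists [:: [::]] => // y; rewrite subseq0 => /eqP ->.
have [E sizeE memE] : exists2 E : seq (seq bool),
    size E <= multichoose (changes a x) t &
    forall y : seq bool, subseq y (a :: x) -> ~~ subseq y x ->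
      size y + t = (size x).+1 -> y \in E.
  have [[L sizeL memL] [E sizeE memE]] := IH t.
  (* If the first run continues into [x], then [y] must start with [a] and its tail again keeps the
     rest of that run whole. Otherwise the run is just [a], the tail of [y] is any subsequence of
     [x], and [runs x] equals [changes a x]. *)
  have [ax|nax] := boolP (ohead x == Some a).
    case: x ax {L sizeL memL} E sizeE memE {IH} => //= b x /eqP[->] E sizeE memE.
    exists (map (cons a) E); first by rewrite size_map eqxx.
    move=> [|c y] //; rewrite /=.
    have [->|/negPf nca] /= := eqVneq c a; last by rewrite nca => ->.
    move=> sub nsub [szy].
    rewrite mem_map; last by move=> ? ? [].
    by apply: memE => //; lia.
  exists (map (cons a) L).
    rewrite size_map; apply: leq_trans sizeL _; apply: leq_multichoose.
    case: x nax {IH sizeE memE memL} => //= b x.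
    by rewrite -(inj_eq (@Some_inj _)) eq_sym => ->.
  move=> [|c y] //=; first by rewrite sub0seq.
  case: eqP => [->|_ ->] //= sub _ szy.
  by rewrite mem_map; [apply: memL => //; lia|move=> ? ? []].
split; last by exists E.
case: t E sizeE memE => [|t] E sizeE memE.
  exists E; first by rewrite multichoose0; move: sizeE; rewrite multichoose0.
  move=> y sub szy; apply: memE => //; apply/negP => /size_subseq.
  by move: szy => /=; lia.
have [[L sizeL memL] _] := IH t.
(* The two sizes add up by Pascal's rule [multichooseS]. *)
exists (L ++ E).
  rewrite size_cat [runs _]/= multichooseS leq_add //.
  apply: leq_trans sizeL _; apply: leq_multichoose.
  by case: x {IH sizeE memE memL} => //= b x; case: (a != b); lia.
move=> y sub szy; rewrite mem_cat.
have [subx|nsubx] := boolP (subseq y x).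
  by rewrite memL //; move: szy => /=; lia.
by rewrite (memE _ sub nsubx szy) orbT.
Qed.

Lemma dS_subseq (t n : nat) (x : n.-tuple bool) (y : (n - t).-tuple bool) :
  y \in dS t x -> subseq y x.
Proof. by rewrite inE => /existsP[m /andP[_ /eqP ->]]; apply: mask_subseq. Qed.

Lemma card_dS_le (t n : nat) (x : n.-tuple bool) :
  t <= n -> #|dS t x| <= multichoose (runs x) t.
Proof.
move=> le_tn; have [[L sizeL memL] _] := subseq_cover x t.
apply: leq_trans sizeL; rewrite cardE -(size_map val).
apply: uniq_leq_size; first by rewrite (map_inj_uniq val_inj) enum_uniq.
move=> _ /mapP[y + ->]; rewrite mem_enum => /dS_subseq sub.
by apply: memL => //; rewrite !size_tuple subnK.
Qed.

Local Open Scope ring_scope.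

(** * Distribution of the number of runs *)

Lemma sum_tuple_cons (V : nmodType) (T : finType) (m : nat) (g : seq T -> V) :
  \sum_(y : m.+1.-tuple T) g y = \sum_(b : T) \sum_(y : m.-tuple T) g (b :: y).
Proof.
rewrite pair_big /=.
rewrite (reindex (fun p : T * m.-tuple T => [tuple of p.1 :: p.2])) //=.
exists (fun y => (thead y, [tuple of behead y])) => [[b y] _ | y _] /=.
  by congr pair; apply: val_inj.
by rewrite [RHS]tuple_eta; apply: val_inj.
Qed.

Lemma sum_changes (V : nmodType) (a : bool) (m : nat) (g : nat -> V) :
  \sum_(y : m.-tuple bool) g (changes a y) = \sum_(s < m.+1) g s *+ 'C(m, s).
Proof.
elim: m a g => [|m IH] a g.
  rewrite big_ord1 bin0 mulr1n (big_pred1 [tuple]) // => y.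
  by apply/esym/eqP; apply: tuple0.
rewrite (sum_tuple_cons _ _ _ (fun y => g (changes a y))) /= big_bool /=.
(* Whatever [a] is, exactly one of the two first letters adds a change; Pascal's rule then merges
   the two sums. *)
have -> : \sum_(y : m.-tuple bool) g ((a != true) + changes true y)%N
        + \sum_(y : m.-tuple bool) g ((a != false) + changes false y)%N
        = \sum_(s < m.+1) g s.+1 *+ 'C(m, s) + \sum_(s < m.+1) g s *+ 'C(m, s).
  case: a; rewrite /= (IH _ g) (IH _ (fun s => g s.+1)) //.
  by rewrite addrC.
rewrite [RHS]big_ord_recl bin0 mulr1n.
under [X in _ = _ + X]eq_bigr => i _ do rewrite /= /bump /= add1n binS mulrnDr.
rewrite big_split /= [X in _ + X = _]big_ord_recl bin0 mulr1n.
rewrite [X in _ = _ + (X + _)]big_ord_recr /= bin_small // mulr0n addr0.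
by rewrite addrC -addrA.
Qed.

Lemma sum_runs (V : nmodType) (m : nat) (g : nat -> V) :
  \sum_(y : m.+1.-tuple bool) g (runs y)
  = (\sum_(s < m.+1) g s.+1 *+ 'C(m, s)) *+ 2.
Proof.
rewrite (sum_tuple_cons _ _ _ (fun y => g (runs y))) /= big_bool /=.
by rewrite !(sum_changes _ _ _ (fun s => g s.+1)) mulr2n.
Qed.

(** * The weighted covering bound *)

Lemma card_covering_ge (F : numFieldType) (t n : nat) (C : {set n.-tuple bool}) :
  (t < n)%N -> dS_set t C = [set: (n - t).-tuple bool] ->
  \sum_(y : (n - t).-tuple bool) (multichoose (runs y + 2 * t) t)%:R^-1
    <= (#|C|)%:R :> F.
Proof.
move=> lt_tn covC; pose h y : F := (multichoose (runs y + 2 * t) t)%:R^-1.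
have h_ge0 y : 0 <= h y by rewrite invr_ge0 ler0n.
have -> : (#|C|)%:R = \sum_(c in C) 1 :> F by rewrite sumr_const.
(* Each word lies in some sphere, so its nonnegative weight is counted at least once. *)
apply: (@le_trans _ _ (\sum_(c in C) \sum_(y in dS t c) h y)).
  rewrite (exchange_big_dep xpredT) //=; apply: ler_sum => y _.
  have : y \in dS_set t C by rewrite covC in_setT.
  case/bigcupP => c cC yc; rewrite (bigD1 c) /=; last by rewrite cC.
  by rewrite lerDl; apply: sumr_ge0.
apply: ler_sum => c _.
have [->|/set0Pn[y0 y0c]] := eqVneq (dS t c) set0; first by rewrite big_set0.
have card_gt0 : (0 < #|dS t c|)%N by apply/card_gt0P; exists y0.
apply: (@le_trans _ _ (\sum_(y in dS t c) (#|dS t c|)%:R^-1)); last first.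
  by rewrite sumr_const -[_ *+ _]mulr_natl mulfV // pnatr_eq0 -lt0n.
apply: ler_sum => y yc.
have le_card : (#|dS t c| <= multichoose (runs y + 2 * t) t)%N.
  apply: leq_trans (card_dS_le _ _ c (ltnW lt_tn)) _; apply: leq_multichoose.
  have szy : (0 < size y)%N by rewrite size_tuple subn_gt0.
  by have := runs_subseq _ _ szy (dS_subseq _ _ _ _ yc); rewrite !size_tuple; lia.
by rewrite lef_pV2 ?posrE ?ltr0n ?ler_nat // (leq_trans card_gt0).
Qed.

(** * Binomial estimates and the tail bound *)

(** For [s <= m] both sides equal [(m + t)! / (s! t! (m - s)!)]. *)
Lemma bin_shift_mul (m s t : nat) :
  ('C(m + t, s + t) * 'C(s + t, t) = 'C(m + t, t) * 'C(m, s))%N.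
Proof.
have [lt_ms|le_sm] := ltnP m s.
  by rewrite (@bin_small m s) ?(@bin_small (m + t) (s + t)) ?muln0 //; lia.
have fact_neq0 : (0 < s`! * t`! * (m - s)`!)%N by rewrite !muln_gt0 !fact_gt0.
apply/eqP; rewrite -(eqn_pmul2r fact_neq0); apply/eqP.
have h1 := bin_fact (leq_add le_sm (leqnn t)).
have h2 := bin_fact (leq_addl s t).
have h3 := bin_fact (leq_addl m t).
have h4 := bin_fact le_sm.
rewrite subnDr in h1; rewrite addnK in h2; rewrite addnK in h3.
transitivity (m + t)`!; last by rewrite -h3 -h4; lia.
by rewrite -h1 -h2; lia.
Qed.

(** Passing from [w] to [w + 1] multiplies ['C(w + t, t)] by [(w + t + 1) / (w + 1)], a factor that
    decreases in [w], so the numerator of ['C(w + t, t) / 'C(w + k + t, t)] grows at least as fast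
    as its denominator. *)
Lemma bin_ratio_mono (u v t k : nat) : (u <= v)%N ->
  ('C(u + t, t) * 'C(v + k + t, t) <= 'C(v + t, t) * 'C(u + k + t, t))%N.
Proof.
move=> le_uv; rewrite -(subnKC le_uv).
elim: (v - u)%N => [|d IH]; first by rewrite addn0.
rewrite addnS !addSn; set w := (u + d)%N in IH *.
have h1 := mul_bin_down (w + t).+1 t; have h2 := mul_bin_down (w + k + t).+1 t.
rewrite /= in h1 h2.
have e1 : ((w + t).+1 - t = w.+1)%N by lia.
have e2 : ((w + k + t).+1 - t = (w + k).+1)%N by lia.
rewrite e1 in h1; rewrite e2 in h2.
rewrite -(@leq_pmul2l (w.+1 * (w + k).+1)) ?muln_gt0 //.
have -> : (w.+1 * (w + k).+1 * ('C(u + t, t) * 'C((w + k + t).+1, t)) =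
           w.+1 * (w + k + t).+1 * ('C(u + t, t) * 'C(w + k + t, t)))%N.
  by rewrite mulnACA -h2; lia.
have -> : (w.+1 * (w + k).+1 * ('C((w + t).+1, t) * 'C(u + k + t, t)) =
           (w + k).+1 * (w + t).+1 * ('C(w + t, t) * 'C(u + k + t, t)))%N.
  by rewrite mulnACA -h1; lia.
by apply: leq_mul => //; nia.
Qed.

(* The bound holds for arbitrary a and b; the choice of cube roots only matters for
   its asymptotic quality. *)
Lemma card_covering_ge_tail (F : realFieldType) (t n a b : nat)
    (C : {set n.-tuple bool}) :
  (t < n)%N -> (0 < b)%N -> dS_set t C = [set: (n - t).-tuple bool] ->
  (2%:R ^+ n / ('C(n - 1, t))%:R)
  * (('C(b + t - 1, t))%:R / ('C(b + a + 3 * t - 1, t))%:R)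
  * (\sum_(0 <= r < n | (a + b.-1 + t <= r)%N)
       ('C(n - 1, r))%:R / 2%:R ^+ (n - 1))
  <= (#|C|)%:R :> F.
Proof.
move=> lt_tn b_gt0 covC; apply: le_trans (card_covering_ge _ _ _ _ lt_tn covC).
have [m def_m] : exists m, (n - t = m.+1)%N by exists (n - t).-1; lia.
rewrite def_m (sum_runs _ _ (fun r => (multichoose (r + 2 * t) t)%:R^-1)).
have {lt_tn def_m C covC} -> : n = (m + t).+1 by lia.
(* The filter excludes every [r < t], so the sum can be reindexed by [r = s + t]. *)
rewrite subSS subn0 (@big_cat_nat _ _ _ t) //=; last by lia.
rewrite [X in _ * (X + _)]big_nat_cond [X in _ * (X + _)]big1 ?add0r; last first.
  by move=> i /andP[]; lia.
have len : ((m + t).+1 - t = m.+1)%N by lia.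
rewrite -[X in \sum_(X <= _ < _ | _) _]add0n big_addn len big_mkord.
rewrite big_mkcond /= mulr_sumr -sumrMnl; apply: ler_sum => s _.
case: leqP => [le_s|_]; last by rewrite mulr0 mulrn_wge0 // mulrn_wge0 // invr_ge0.
have binN0 : ('C(m + t, t))%:R != 0 :> F by rewrite pnatr_eq0 -lt0n bin_gt0 leq_addl.
have pos k : 0 < ('C(k + t, t))%:R :> F by rewrite ltr0n bin_gt0 leq_addl.
have two_gt0 : 0 < 2%:R ^+ (m + t) :> F by rewrite exprn_gt0.
have -> : multichoose (s.+1 + 2 * t) t = 'C(s + 2 * t + t, t).
  by rewrite /multichoose !addSn.
have -> : (b + t - 1 = b.-1 + t)%N by lia.
have -> : (b + a + 3 * t - 1 = (a + b.-1) + 2 * t + t)%N by lia.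
(* Monotonicity of the ratio from [a + b.-1] to [s], after enlarging the numerator from [b.-1] to
   [a + b.-1]. *)
have ratio : ('C(b.-1 + t, t))%:R / ('C(a + b.-1 + 2 * t + t, t))%:R
    <= ('C(s + t, t))%:R / ('C(s + 2 * t + t, t))%:R :> F.
  rewrite ler_pdivrMr // mulrAC ler_pdivlMr // -!natrM ler_nat.
  have le_s' : (a + b.-1 <= s)%N by lia.
  apply: leq_trans (bin_ratio_mono _ _ t (2 * t) le_s').
  by apply: leq_mul => //; apply: leq_bin2l; lia.
have shift : ('C(m, s))%:R =
    ('C(m + t, s + t))%:R * ('C(s + t, t))%:R / ('C(m + t, t))%:R :> F.
  by rewrite -natrM bin_shift_mul natrM mulrAC mulfV // mul1r.
rewrite -[_ *+ 'C(m, s)]mulr_natl shift.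
have coef_ge0 : 0 <= 2 * ('C(m + t, s + t))%:R / ('C(m + t, t))%:R :> F.
  by rewrite divr_ge0 ?mulr_ge0.
have := ler_wpM2l coef_ge0 ratio; congr (_ <= _).
  rewrite exprS; move: (2 ^+ (m + t)) two_gt0 => p p_gt0.
  by field; rewrite binN0 !lt0r_neq0.
by rewrite -[RHS]mulr_natl;  field; rewrite binN0 !lt0r_neq0.
Qed.

Lemma sum_bin_div_pow2 (F : numFieldType) (n : nat) : (0 < n)%N ->
  \sum_(0 <= r < n) ('C(n - 1, r))%:R / 2%:R ^+ (n - 1) = 1 :> F.
Proof.
case: n => // n _; rewrite subSS subn0 -mulr_suml big_mkord.
have sum_bin : (\sum_(i < n.+1) 'C(n, i) = 2 ^ n)%N.
  rewrite -[2%N]/(1 + 1)%N expnDn; apply: eq_bigr => i _.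
  by rewrite !exp1n !muln1.
by rewrite -natr_sum sum_bin natrX mulfV // expf_neq0 // pnatr_eq0.
Qed.

Theorem theorem2 (R : realType) (t n : nat) (C : {set n.-tuple bool})
    (t_gt0 : (0 < t)%N) (t_lt_n : (t < n)%N)
    (perfC : perfect_deletion_code t C) :
  let a := floor_cbrt R n in
  let b := floor_cbrt_sqr R n in
  (#|C|)%:R >=
    (2%:R ^+ n / ('C(n - 1, t))%:R)
    * ((a + 1)%:R / (a + 1 + 2 * t)%:R)
    * (('C(b + t - 1, t))%:R / ('C(b + a + 3 * t - 1, t))%:R)
    * (1
       - \sum_(0 <= r < n | r%:Z < a%:Z - 1 + b%:Z + t%:Z)
           ('C(n - 1, r))%:R / 2%:R ^+ (n - 1)
       - \sum_(0 <= r < n | r%:Z > n%:Z - 1 - b%:Z + t%:Z)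
           ('C(n - 1, r))%:R / 2%:R ^+ (n - 1)) :> R.
Proof.
cbv zeta; move: (floor_cbrt R n) (floor_cbrt_sqr R n) => a b.
(* For [b = 0] the factor ['C(t - 1, t)] vanishes, since [t > 0]. *)
have [->|b_gt0] := posnP b.
  by rewrite add0n (@bin_small (t - 1)) ?mul0r ?mulr0 ?mul0r //; lia.
have [_ covC] := perfC.
apply: le_trans (card_covering_ge_tail R t n a b C t_lt_n b_gt0 covC).
set tail := \sum_(0 <= r < n | (a + b.-1 + t <= r)%N) _.
set bracket := 1 - _ - _.
have tail_ge0 : 0 <= tail by apply: sumr_ge0 => r _; rewrite divr_ge0 ?exprn_ge0.
(* For [b > 0] the first subtracted sum is exactly the complement of [tail]; the second is
   nonnegative. *)
have le_tail : bracket <= tail.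
  rewrite /bracket -[X in X - _ - _](sum_bin_div_pow2 R n) ?(leq_trans _ t_lt_n) //.
  rewrite [X in X - _ - _](bigID (fun r => (a + b.-1 + t <= r)%N)) /= -/tail.
  rewrite [X in _ - X - _](_ : _ = \sum_(0 <= r < n | ~~ (a + b.-1 + t <= r)%N)
      ('C(n - 1, r))%:R / 2%:R ^+ (n - 1)); last by apply: eq_bigl => r; lia.
  by rewrite addrK gerBl; apply: sumr_ge0 => r _; rewrite divr_ge0 ?exprn_ge0.
have pre_ge0 : 0 <= 2%:R ^+ n / ('C(n - 1, t))%:R :> R.
  by rewrite divr_ge0 ?exprn_ge0.
have K_ge0 : 0 <= ('C(b + t - 1, t))%:R / ('C(b + a + 3 * t - 1, t))%:R :> R.
  by rewrite divr_ge0.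
have q_ge0 : 0 <= (a + 1)%:R / (a + 1 + 2 * t)%:R :> R by rewrite divr_ge0.
have q_le1 : (a + 1)%:R / (a + 1 + 2 * t)%:R <= 1 :> R.
  by rewrite ler_pdivrMr ?mul1r ?ler_nat ?ltr0n; lia.
(* The bracket may be negative, so it is replaced by [tail >= 0] before the factor
   [(a + 1) / (a + 1 + 2 * t)] is raised to 1. *)
apply: (le_trans (ler_wpM2l _ le_tail)); first by apply: mulr_ge0 => //; apply: mulr_ge0.
apply: ler_wpM2r => //; apply: ler_wpM2r => //.
by rewrite -[leRHS]mulr1; apply: ler_wpM2l.
Qed.
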